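(* There exists a set $P\subset\mathbb{R}_{>0}\times\mathbb{R}_{>0}$ such that $$\left|\left\{x\in\mathbb{R}_{>0}:\ |\{y\in\mathbb{R}_{>0}\mid (x,y)\in P\text{ or }(y,x)\in P\}|=\infty\right\}\right|<\infty$$ and for all $(\lambda_2,\lambda_3)\in(\mathbb{R}_{>0}\times\mathbb{R}_{>0})\setminus P$ and symmetric $Y\in M_{3\times3}(\mathbb{R})$ the following are equivalent: (i) There exists a matrix $X\in M_{81\times 81}(\mathbb{C})$ solving the system of linear equations $$\psi(Q_{i_4}^*\otimes Q_{i_5}^* )^*X\psi(Q_{i_1}(Q_{i_2}\otimes Q_{i_3}))-\psi(Q_{i_1}^*(Q_{i_4}^*\otimes Q_{i_5}^* ))^*X\psi(Q_{i_2}\otimes Q_{i_3})=0\quad(1\le i_1,\dots,i_5\le 9),$$ $$\psi(Q_{i_4}^*\otimes Q_{i_5}^* )^*X\psi((Q_{i_2}\otimes Q_{i_3})Q_{i_1})-\psi((Q_{i_4}^*\otimes Q_{i_5}^* )Q_{i_1}^* )^*X\psi(Q_{i_2}\otimes Q_{i_3})=0\quad(1\le i_1,\dots,i_5\le 9),$$ $$\psi(Q_{i_2}^*\otimes 1)^*X\psi(Q_{i_1}\otimes 1)-f_Y(Q_{i_1},Q_{i_2}^* )=0\quad(1\le i_1,i_2\le 9).$$ (ii) $Y$ satisfies $$\frac{(1-\lambda_3^2-\lambda_2^2)(\lambda_3^2-\lambda_2^2)}{\lambda_3\lambda_2}Y_{23}+\frac{(\lambda_3^2-1-\lambda_2^2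)(\lambda_2^2-1)}{\lambda_2}Y_{12}+\frac{(\lambda_2^2-1-\lambda_3^2)(1-\lambda_3^2)}{\lambda_3}Y_{13}+(\lambda_3^2-\lambda_2^2)Y_{11}+(1-\lambda_3^2)Y_{22}+(\lambda_2^2-1)Y_{33}=0.$$
   Context: Let $\mathcal{A}=M_{3\times3}(\mathbb{C})$ with matrix units $E_{ij}$, $1\le i,j\le3$. Put $\lambda_1=1$. Given $\lambda_2,\lambda_3>0$, let $\rho$ be the state $$\rho(A)=\frac{1}{\lambda_1^2+\lambda_2^2+\lambda_3^2}\mathrm{Tr}\left(\mathrm{diag}(\lambda_1^2,\lambda_2^2,\lambda_3^2)A\right),$$ and let $\omega_{kl}\in\mathbb{R}$ be defined by $e^{-\omega_{kl}}=\lambda_k^2/\lambda_l^2$. For symmetric $Y\in M_{3\times3}(\mathbb{R})$ define $L_Y:\mathcal{A}\to\mathcal{A}$ by $$L_Y(A)=-\sum_{i,j=1}^3Y_{ij}e^{-\omega_{ij}/2}\left(E_{ij}^*[A,E_{ij}]+[E_{ij}^*,A]E_{ij}\right),$$ and $f_Y:\mathcal{A}\times\mathcal{A}\to\mathbb{C}$ by $f_Y(A,B)=\rho(B^*L_Y(A))$. $\mathcal{Q}=\{Q_1,\dots,Q_9\}=\{E_{ij}\mid1\le i,j\le3\}$ is the basis of matrix units, and $\psi:\mathcal{A}\otimes\mathcal{A}\to\mathbb{C}^{81}$ is the linear isomorphism $\psi(E_{ij}\otimes E_{kl})=e_{27i+9k+3j+l-39}$, where $(e_r)$ is the standard basis of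 $\mathbb{C}^{81}$ (column vectors); $v^*$ denotes the conjugate transpose of $v$. The left and right actions of $\mathcal{A}$ on $\mathcal{A}\otimes\mathcal{A}$ are $A(B\otimes C)=AB\otimes C-A\otimes BC$ and $(B\otimes C)D=B\otimes CD$. No positivity of $X$ is required. $|\cdot|$ denotes cardinality, and $|\cdot|=\infty$ means the set is infinite. *)

(* Defs.v *)
From HB Require Import structures.
From mathcomp Require Import all_boot all_order all_algebra.
From mathcomp Require Import all_classical all_reals all_analysis.
From mathcomp.real_closed Require Import complex.
(* The notations of mxtens clash with those of sesquilinear. *)
From mathcomp.real_closed Require Import -(notations) mxtens.

Set Implicit Arguments.
Unset Strict Implicit.
Unset Printing Implicit Defensive.

Import Order.TTheory GRing.Theory Num.Theory.
Local Open Scope ring_scope.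
Local Open Scope complex_scope.
Local Open Scope sesquilinear_scope.

(* Matrix indices range over 'I_3 and start at 0, so that for instance the
   entry written Y_{23} with indices starting at 1 is [Y 1 2]. *)

Definition adj (R : realType) m n (a : 'M[R[i]]_(m, n)) : 'M[R[i]]_(n, m) :=
  a^t*.
Notation "a ^†" := (adj a) (at level 2, format "a ^†")
  : ring_scope.

(* A ⊗ A is realized by the Kronecker product, as 9 x 9 matrices. *)
Definition tens (R : realType) (b c : 'M[R[i]]_3) : 'M[R[i]]_(3 * 3) :=
  tensmx b c.
Notation "b ⊗ c" := (tens b c) (at level 40, left associativity) : ring_scope.

Section MatrixForms.
Variable R : realType.
Notation C := R[i].
Notation A := 'M[C]_3.
Notation AA := 'M[C]_(3 * 3).

Definition E (i j : 'I_3) : A := delta_mx i j.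

Definition Q (r : 'I_9) : A := E (inord (r %/ 3)) (inord (r %% 3)).

(* The coefficient of E_ij ⊗ E_kl in T. *)
Definition tcoord (T : AA) (i j k l : 'I_3) : C :=
  T (mxtens_index (i, k)) (mxtens_index (j, l)).

(* The linear map on A ⊗ A sending E_ij ⊗ E_kl to [g i j k l]. *)
Definition tlift (V : lmodType C) (g : 'I_3 -> 'I_3 -> 'I_3 -> 'I_3 -> V)
    (T : AA) : V :=
  \sum_i \sum_j \sum_k \sum_l tcoord T i j k l *: g i j k l.

(* With indices starting at 0, 27i + 9k + 3j + l - 39 becomes
   27i + 9k + 3j + l; it ranges over 0, ..., 80. *)
Definition psi : AA -> 'cV[C]_81 :=
  tlift (fun i j k l => delta_mx (inord (27 * i + 9 * k + 3 * j + l)) 0).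

Definition lact (a : A) : AA -> AA :=
  tlift (fun i j k l => (a *m E i j) ⊗ E k l - a ⊗ (E i j *m E k l)).

Definition ract (T : AA) (d : A) : AA :=
  tlift (fun i j k l => E i j ⊗ (E k l *m d)) T.

Definition lam (l2 l3 : R) (i : 'I_3) : R := [:: 1; l2; l3]`_i.

Definition rho (l2 l3 : R) (a : A) : C :=
  (\sum_i lam l2 l3 i ^+ 2)^-1%:C *
  \tr (diag_mx (\row_i (lam l2 l3 i ^+ 2)%:C) *m a).

Definition omega (l2 l3 : R) (k l : 'I_3) : R :=
  - ln (lam l2 l3 k ^+ 2 / lam l2 l3 l ^+ 2).

Definition comm (a b : A) : A := a *m b - b *m a.

Definition L (l2 l3 : R) (Y : 'M[R]_3) (a : A) : A :=
  - \sum_i \sum_j (Y i j * expR (- omega l2 l3 i j / 2))%:C *: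
      ((E i j)^† *m comm a (E i j) + comm (E i j)^† a *m E i j).

Definition f (l2 l3 : R) (Y : 'M[R]_3) (a b : A) : C :=
  rho l2 l3 (b^† *m L l2 l3 Y a).

Lemma expR_omega (l2 l3 : R) (k l : 'I_3) : 0 < l2 -> 0 < l3 ->
  expR (- omega l2 l3 k l) = lam l2 l3 k ^+ 2 / lam l2 l3 l ^+ 2.
Proof.
move=> l2_gt0 l3_gt0; have lam_gt0 i : 0 < lam l2 l3 i.
  by case: i => [[|[|[|]]]].
by rewrite opprK lnK // posrE divr_gt0 ?exprn_gt0.
Qed.

Lemma tcoord_tens (b c : A) i j k l : tcoord (b ⊗ c) i j k l = b i j * c k l.
Proof. exact: tensmxE. Qed.

Lemma tlift_E (V : lmodType C) (g : 'I_3 -> 'I_3 -> 'I_3 -> 'I_3 -> V) i j k l :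
  tlift g (E i j ⊗ E k l) = g i j k l.
Proof.
rewrite /tlift (bigD1 i) //= (bigD1 j) //= (bigD1 k) //= (bigD1 l) //=.
rewrite tcoord_tens !mxE !eqxx mulr1 scale1r.
rewrite !big1 ?addr0 //.
- move=> i' /negPf ni; rewrite !big1 // => j' _; rewrite !big1 // => k' _.
  by rewrite !big1 // => l' _; rewrite tcoord_tens !mxE ni mul0r scale0r.
- move=> j' /negPf nj; rewrite !big1 // => k' _; rewrite !big1 // => l' _.
  by rewrite tcoord_tens !mxE nj andbF mul0r scale0r.
- move=> k' /negPf nk; rewrite !big1 // => l' _.
  by rewrite tcoord_tens !mxE nk mulr0 scale0r.
- by move=> l' /negPf nl; rewrite tcoord_tens !mxE nl andbF mulr0 scale0r.
Qed.

Lemma psi_E i j k l : psi (E i j ⊗ E k l) =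
  delta_mx (inord (27 * i + 9 * k + 3 * j + l)) 0.
Proof. exact: tlift_E. Qed.

Lemma tlift_tens (V : lmodType C) (g : A -> A -> V) (b c : A) :
  (forall x, linear (g x)) -> (forall y, linear (g^~ y)) ->
  tlift (fun i j k l => g (E i j) (E k l)) (b ⊗ c) = g b c.
Proof.
move=> gr gl.
have sumZ (h : A -> V) : linear h -> forall m : A,
    \sum_i \sum_j m i j *: h (E i j) = h m.
  move=> lh m; pose H := GRing.isLinear.Build _ _ _ _ h lh.
  pose hL : {linear A -> V} := HB.pack h H.
  rewrite [in RHS](matrix_sum_delta m) -[RHS]/(hL _) linear_sum.
  by apply: eq_bigr => i _; rewrite linear_sum; apply: eq_bigr => j _;
     rewrite linearZ.
rewrite -(sumZ _ (gl c)) /tlift; apply: eq_bigr => i _; apply: eq_bigr => j _.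
rewrite -(sumZ _ (gr _)) scaler_sumr; apply: eq_bigr => k _.
rewrite scaler_sumr; apply: eq_bigr => l _.
by rewrite tcoord_tens scalerA.
Qed.

Lemma tens_linearr (b : A) : linear (fun c : A => b ⊗ c : AA).
Proof.
by move=> x u v; apply/matrixP => i j; rewrite !mxE mulrDr mulrCA.
Qed.

Lemma tens_linearl (c : A) : linear (fun b : A => b ⊗ c : AA).
Proof.
by move=> x u v; apply/matrixP => i j; rewrite !mxE mulrDl mulrA.
Qed.

Lemma lact_tens (a b c : A) : lact a (b ⊗ c) = (a *m b) ⊗ c - a ⊗ (b *m c).
Proof.
apply: (tlift_tens (g := fun b c => (a *m b) ⊗ c - a ⊗ (b *m c))) => y x u v.
  by rewrite mulmxDr -scalemxAr !tens_linearr scalerBr addrACA opprD.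
rewrite mulmxDr mulmxDl -scalemxAr -scalemxAl.
by rewrite tens_linearl tens_linearr scalerBr addrACA opprD.
Qed.

Lemma ract_tens (b c d : A) : ract (b ⊗ c) d = b ⊗ (c *m d).
Proof.
apply: (tlift_tens (g := fun b c => b ⊗ (c *m d))) => y x u v.
  by rewrite mulmxDl -scalemxAl tens_linearr.
by rewrite tens_linearl.
Qed.

End MatrixForms.

Arguments E {R}.
Arguments Q {R}.

(* Main.v *)
From HB Require Import structures.
Require Import Defs.
From mathcomp Require Import all_boot all_order all_algebra.
From mathcomp Require Import all_classical all_reals all_analysis.
From mathcomp.real_closed Require Import complex.
From mathcomp Require Import ring lra.
Import Order.TTheory GRing.Theory Num.Theory.
Local Open Scope classical_set_scope.
Local Open Scope ring_scope.

(** The exceptional set P can be taken empty: the equivalence holds for all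
positive lambda_2, lambda_3.

Write delta(B) = B ⊗ 1 - 1 ⊗ B.  Under B ⊗ C |-> delta(B) C, the twisted left
action on A ⊗ A becomes the obvious one on the bimodule of noncommutative
one-forms, so the first two systems say that X defines a sesquilinear form s on
A ⊗ A for which both actions are *-actions, and the third says that
s(A ⊗ 1, B ⊗ 1) = f_Y(A, B).

Necessity.  Put m(A, B) = s(A ⊗ 1, B^* ⊗ 1).  The Leibniz rule and invariance
give
  m(AB, C) = m(B, CA) - t(B, C, A) + t(A, B, C),
with t(A, B, C) = s(A ⊗ B, C^* ⊗ 1).  Summed over the cyclic shifts of
(A, B, C), the t-terms cancel, so the antisymmetric part of m is a cyclic
cocycle.  On three matrix units whose product closes up this gives
[cyclic_cocycle].  For m = f_Y the value m(E_kl, E_lk) - m(E_lk, E_kl) is, up to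
the normalization of rho, the number [asym k l], and the vanishing of
asym 1 2 + asym 2 3 + asym 3 1 is the linear condition on Y ([asym_cycle]).

Sufficiency.  For every matrix x, B ⊗ C |-> [x, B] C is a bimodule map from
A ⊗ A to A, where the trace provides an invariant form.  Hence every
combination of the forms tr([y, B]^* [x, A]) comes from an invariant X
([formmxE], [derform_lact], [derform_ract]), and it remains to write f_Y as such
a combination, that is, to write A |-> L_Y(A) D, with
D = diag(lambda_1^2, lambda_2^2, lambda_3^2), as a sum of double commutators.
Covariance under the diagonal torus restricts the choice to the pairs
(E_ij, E_ij), with weights p, and (E_ii, E_jj), with weights q.  The diagonal
block of the operator fixes p_ij + p_ji; the differences p_ij - p_ji must
account for the antisymmetric part asym, which they can do exactly when asym is
a cocycle; what is left of the off-diagonal entries is then symmetric in (k, l)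
and is absorbed by q ([qcoef_sym], [dcomm_L]). *)

(** * Adjoints and the trace inner product *)

Section Adjoint.
Set Implicit Arguments.
Unset Strict Implicit.
Variable R : realType.
Notation C := R[i].

Lemma adjM m n p (a : 'M[C]_(m, n)) (b : 'M[C]_(n, p)) :
  (a *m b)^† = b^† *m a^†.
Proof. by rewrite /adj trmx_mul map_mxM. Qed.

Lemma adjB m n (a b : 'M[C]_(m, n)) : (a - b)^† = a^† - b^†.
Proof. by apply/matrixP => i j; rewrite !mxE rmorphB. Qed.

Lemma adj_sum m n I (r : seq I) (F : I -> 'M[C]_(m, n)) :
  (\sum_(i <- r) F i)^† = \sum_(i <- r) (F i)^†.
Proof.
by apply/matrixP => i j; rewrite !mxE !summxE rmorph_sum; apply: eq_bigr => k _;
   rewrite !mxE.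
Qed.

Lemma adjK m n (a : 'M[C]_(m, n)) : a^†^† = a.
Proof. by apply/matrixP => i j; rewrite !mxE conjCK. Qed.

Lemma adj_E (i j : 'I_3) : (E i j)^† = E j i :> 'M[C]_3.
Proof. by apply/matrixP => k l; rewrite !mxE conjC_nat andbC. Qed.

Lemma mxtrace_adjM (a b : 'M[C]_3) :
  ((mxvec b)^T)^† *m (mxvec a)^T = (\tr (b^† *m a))%:M.
Proof.
rewrite [LHS]mx11_scalar; congr _%:M; rewrite mxE /mxtrace.
under [RHS]eq_bigr do rewrite mxE.
rewrite exchange_big pair_bigA.
rewrite (reindex _ (curry_mxvec_bij _ _)) /=.
by apply: eq_bigr => -[i j] _; rewrite !mxE /= !mxvecE.
Qed.

End Adjoint.

(** * Inner derivations as bimodule maps *)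

Section Tlift.
Set Implicit Arguments.
Unset Strict Implicit.
Variable R : realType.
Notation C := R[i].
Notation A := 'M[C]_3.
Notation AA := 'M[C]_(3 * 3).

Lemma tlift_is_linear (V : lmodType C) g : linear (@tlift R V g).
Proof.
move=> c u v; rewrite /tlift scaler_sumr -big_split; apply: eq_bigr => i _ /=.
rewrite scaler_sumr -big_split; apply: eq_bigr => j _ /=.
rewrite scaler_sumr -big_split; apply: eq_bigr => k _ /=.
rewrite scaler_sumr -big_split; apply: eq_bigr => l _ /=.
by rewrite /tcoord !mxE scalerDl scalerA.
Qed.

HB.instance Definition _ (V : lmodType C) g :=
  GRing.isLinear.Build _ _ _ _ (@tlift R V g) (@tlift_is_linear V g).

Lemma linear_tlift (V W : lmodType C) (h : {linear V -> W}) g (T : AA) :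
  h (tlift g T) = tlift (fun i j k l => h (g i j k l)) T.
Proof.
rewrite /tlift linear_sum; apply: eq_bigr => i _.
rewrite linear_sum; apply: eq_bigr => j _.
rewrite linear_sum; apply: eq_bigr => k _.
by rewrite linear_sum; apply: eq_bigr => l _; rewrite linearZ.
Qed.

Lemma eq_tlift (V : lmodType C) g h (T : AA) :
  (forall i j k l, g i j k l = h i j k l) -> tlift g T = tlift h T :> V.
Proof.
move=> gh; rewrite /tlift; apply: eq_bigr => i _; apply: eq_bigr => j _.
by apply: eq_bigr => k _; apply: eq_bigr => l _; rewrite gh.
Qed.

Lemma psiB (T U : AA) : psi (T - U) = psi T - psi U.
Proof. exact: (raddfB (@tlift R _ _)). Qed.

(** The bimodule map induced by the inner derivation [x, -] through the
universal property of one-forms: delta(b) c is sent to [x, b] c. *)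
Definition der (x : A) : AA -> A :=
  tlift (fun i j k l => comm x (E i j) *m E k l).

Lemma derB x (T U : AA) : der x (T - U) = der x T - der x U.
Proof. exact: (raddfB (@tlift R _ _)). Qed.

Lemma der_tens x b c : der x (b ⊗ c) = comm x b *m c.
Proof.
apply: (tlift_tens (g := fun b c => comm x b *m c)) => [y|y] t u v.
  by rewrite mulmxDr -scalemxAr.
rewrite scalemxAl -mulmxDl; congr (_ *m _).
by rewrite /comm mulmxDr mulmxDl -scalemxAr -scalemxAl opprD addrACA -scalerBr.
Qed.

(** The term a ⊗ bc of the twisted action removes exactly the summand
[x, a] b c that the Leibniz rule produces from [x, ab] c. *)
Lemma der_lact x a b c : der x (lact a (b ⊗ c)) = a *m der x (b ⊗ c).
Proof.
rewrite lact_tens derB !der_tens /comm !mulmxBl !mulmxBr !mulmxA.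
by rewrite opprB addrC addrA subrK.
Qed.

Lemma der_ract x b c d : der x (ract (b ⊗ c) d) = der x (b ⊗ c) *m d.
Proof. by rewrite ract_tens !der_tens mulmxA. Qed.

(** The matrix of [der x] in the coordinates given by psi and mxvec: column t
belongs to the basis tensor whose indices are the base 3 digits of t, which
psi orders as i, k, j, l. *)
Definition dermx (x : A) : 'M[C]_(3 * 3, 81) :=
  \matrix_(r, t) mxvec (comm x (E (inord (t %/ 27)) (inord (t %/ 3 %% 3)))
     *m E (inord (t %/ 9 %% 3)) (inord (t %% 3))) 0 r.

Lemma psi_index_digits (i j k l : 'I_3) (r := (27 * i + 9 * k + 3 * j + l)%N) :
  [/\ (r < 81)%N, (r %/ 27 = i)%N, (r %/ 3 %% 3 = j)%N, (r %/ 9 %% 3 = k)%N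
    & (r %% 3 = l)%N].
Proof.
by case: i j k l @r => [[|[|[|//]]] ?] [[|[|[|//]]] ?] [[|[|[|//]]] ?]
  [[|[|[|//]]] ?].
Qed.

Lemma dermxE x T : dermx x *m psi T = (mxvec (der x T))^T.
Proof.
rewrite /psi (linear_tlift (mulmx (dermx x))).
rewrite /der (linear_tlift (mxvec : {linear _ -> _})).
rewrite (linear_tlift (trmx : {linear _ -> _})).
apply: eq_tlift => i j k l; rewrite /= -colE; apply/colP => r; rewrite !mxE.
have [lt81 i_r j_r k_r l_r] := psi_index_digits i j k l.
by rewrite inordK // i_r j_r k_r l_r !inord_val.
Qed.

Lemma dermx_form x y T U :
  (psi T)^† *m ((dermx y)^† *m dermx x) *m psi U =
  (\tr ((der y T)^† *m der x U))%:M.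
Proof. by rewrite !mulmxA -adjM -mulmxA !dermxE mxtrace_adjM. Qed.

End Tlift.

(** * Invariant forms satisfy the cyclic cocycle identity *)

Section Cocycle.
Set Implicit Arguments.
Unset Strict Implicit.
Variable R : realType.
Notation C := R[i].
Notation A := 'M[C]_3.
Notation AA := 'M[C]_(3 * 3).

Definition psiform (X : 'M[C]_81) (T U : AA) : C :=
  ((psi U)^† *m X *m psi T) 0 0.

Lemma psiformBl X T T' U :
  psiform X (T - T') U = psiform X T U - psiform X T' U.
Proof. by rewrite /psiform psiB mulmxBr !mxE. Qed.

Lemma psiformBr X T U U' :
  psiform X T (U - U') = psiform X T U - psiform X T U'.
Proof. by rewrite /psiform psiB adjB mulmxBl mulmxBl mxE [X in _ + X]mxE. Qed.

Lemma psiform_suml X I (r : seq I) F U :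
  psiform X (\sum_(i <- r) F i) U = \sum_(i <- r) psiform X (F i) U.
Proof.
by rewrite /psiform /psi (raddf_sum (@tlift R _ _)) mulmx_sumr summxE.
Qed.

Lemma psiform_sumr X I (r : seq I) T F :
  psiform X T (\sum_(i <- r) F i) = \sum_(i <- r) psiform X T (F i).
Proof.
by rewrite /psiform /psi (raddf_sum (@tlift R _ _)) adj_sum !mulmx_suml summxE.
Qed.

Lemma tens1_sum (b : A) : b ⊗ 1%:M = \sum_k b ⊗ E k k.
Proof.
pose H := GRing.isLinear.Build _ _ _ _ _ (@tens_linearr R b).
pose h : {linear A -> AA} := HB.pack (fun c : A => b ⊗ c : AA) H.
rewrite -(linear_sum h) /=; congr (b ⊗ _).
by rewrite -diag_const_mx diag_mx_sum_delta; apply: eq_bigr => i _;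
   rewrite mxE scale1r.
Qed.

(** The invariance equations only speak of tensors of matrix units, whereas the
cocycle identity lives on tensors b ⊗ 1; expanding 1 as the sum of the E_kk
bridges the two.  Both actions are of the form [tlift g]. *)
Lemma psiform_adjoint1 X g g' b d :
  (forall k l, psiform X (tlift g (b ⊗ E k k)) (d ⊗ E l l) =
               psiform X (b ⊗ E k k) (tlift g' (d ⊗ E l l))) ->
  psiform X (tlift g (b ⊗ 1%:M)) (d ⊗ 1%:M) =
  psiform X (b ⊗ 1%:M) (tlift g' (d ⊗ 1%:M)).
Proof.
move=> adj_g; rewrite !tens1_sum !raddf_sum /= !psiform_suml.
apply: eq_bigr => k _; rewrite !psiform_sumr; apply: eq_bigr => l _.
exact: adj_g.
Qed.

Lemma Q_surj i j : exists r, Q r = E i j :> A.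
Proof.
exists (inord (3 * i + j)); rewrite /Q.
have [r9 ri rj] : [/\ (3 * i + j < 9)%N, ((3 * i + j) %/ 3 = i)%N
    & ((3 * i + j) %% 3 = j)%N].
  by case: i j => [[|[|[|//]]] ?] [[|[|[|//]]] ?].
by rewrite inordK // ri rj !inord_val.
Qed.

(** The adjoint makes this bilinear, so that its antisymmetric part makes
sense. *)
Definition bilin (X : 'M[C]_81) (a b : A) : C :=
  psiform X (a ⊗ 1%:M) (b^† ⊗ 1%:M).

(** With m = bilin X and n(a, b) = m(a, b) - m(b, a), this is
n(ab, c) + n(bc, a) + n(ca, b) = 0 for a = E_ij, b = E_jk, c = E_ki. *)
Lemma cyclic_cocycle X :
  (forall i1 i2 i3 i4 i5 : 'I_9,
     (psi ((Q i4)^† ⊗ (Q i5)^†))^† *m X *m psi (lact (Q i1) (Q i2 ⊗ Q i3))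
     - (psi (lact (Q i1)^† ((Q i4)^† ⊗ (Q i5)^†)))^† *m X
       *m psi (Q i2 ⊗ Q i3) = 0) ->
  (forall i1 i2 i3 i4 i5 : 'I_9,
     (psi ((Q i4)^† ⊗ (Q i5)^†))^† *m X *m psi (ract (Q i2 ⊗ Q i3) (Q i1))
     - (psi (ract ((Q i4)^† ⊗ (Q i5)^†) (Q i1)^†))^† *m X
       *m psi (Q i2 ⊗ Q i3) = 0) ->
  forall i j k : 'I_3,
    (bilin X (E i k) (E k i) - bilin X (E k i) (E i k))
  + (bilin X (E j i) (E i j) - bilin X (E i j) (E j i))
  + (bilin X (E k j) (E j k) - bilin X (E j k) (E k j)) = 0.
Proof.
move=> lactX ractX i j k; set m := bilin X.
have lactm p q r s t u :
    psiform X (lact (E p q) (E r s ⊗ 1%:M)) (E t u ⊗ 1%:M) =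
    psiform X (E r s ⊗ 1%:M) (lact (E q p) (E t u ⊗ 1%:M)).
  apply: psiform_adjoint1 => v w.
  have [i1 Q1] := Q_surj p q; have [i2 Q2] := Q_surj r s.
  have [i3 Q3] := Q_surj v v; have [i4 Q4] := Q_surj u t.
  have [i5 Q5] := Q_surj w w.
  have := lactX i1 i2 i3 i4 i5; rewrite Q1 Q2 Q3 Q4 Q5 !adj_E.
  exact: (fun eqX => congr1 (fun M : 'M[C]_1 => M 0 0) (subr0_eq eqX)).
have ractm p q r s t u :
    psiform X (ract (E r s ⊗ 1%:M) (E p q)) (E t u ⊗ 1%:M) =
    psiform X (E r s ⊗ 1%:M) (ract (E t u ⊗ 1%:M) (E q p)).
  apply: psiform_adjoint1 => v w.
  have [i1 Q1] := Q_surj p q; have [i2 Q2] := Q_surj r s.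
  have [i3 Q3] := Q_surj v v; have [i4 Q4] := Q_surj u t.
  have [i5 Q5] := Q_surj w w.
  have := ractX i1 i2 i3 i4 i5; rewrite Q1 Q2 Q3 Q4 Q5 !adj_E.
  exact: (fun eqX => congr1 (fun M : 'M[C]_1 => M 0 0) (subr0_eq eqX)).
pose T (a b c : A) := psiform X (a ⊗ b) (c^† ⊗ 1%:M).
(* For a = E p q and b = E r s, delta(ab) = a.delta(b) + delta(a) b; in the
   first summand a moves to the second slot. *)
have m_split p q r s t u :
    m (E p q *m E r s) (E t u) = m (E r s) (E t u *m E p q)
      - T (E r s) (E t u) (E p q) + T (E p q) (E r s) (E t u).
  have := lactm p q r s u t; rewrite !lact_tens !mulmx1 psiformBl psiformBr.
  have := ractm t u r s q p; rewrite !ract_tens !mul1mx => <-.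
  by rewrite /m /T /bilin adjM !adj_E => /(canRL (subrK _)) ->; rewrite addrC.
clearbody m T.
(* The three shifts telescope: each T cancels against that of the next. *)
have := m_split i j j k k i; have := m_split j k k i i j.
have := m_split k i i j j k; rewrite !mul_delta_mx.
rewrite -!/(E _ _) => -> -> ->.
ring.
Qed.

End Cocycle.

(** * Entries of commutators with matrix units *)

Section Entries.
Set Implicit Arguments.
Unset Strict Implicit.
Variable R : realType.
Notation C := R[i].
Notation A := 'M[C]_3.
Implicit Types (a b : A) (i j k l : 'I_3).

Lemma sum_delta (K : pzRingType) n (k : 'I_n) (F : 'I_n -> K) :
  \sum_i (k == i)%:R * F i = F k.
Proof.
rewrite (bigD1 k) //= eqxx mul1r big1 ?addr0 // => i /negPf.
by rewrite eq_sym => ->; rewrite mul0r.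
Qed.

Lemma mul_E_entry a i j k l : (E i j *m a) k l = (k == i)%:R * a j l.
Proof.
rewrite mxE -(sum_delta j (fun q => (k == i)%:R * a q l)).
apply: eq_bigr => q _.
by rewrite mxE (eq_sym q) -mulnb natrM mulrCA mulrA.
Qed.

Lemma mulr_E_entry a i j k l : (a *m E i j) k l = (l == j)%:R * a k i.
Proof.
rewrite mxE -(sum_delta i (fun q => (l == j)%:R * a k q)).
apply: eq_bigr => q _.
by rewrite mxE (eq_sym q) -mulnb natrM mulrC mulrA.
Qed.

Lemma comm_E_entry a i j k l :
  comm (E i j) a k l = (k == i)%:R * a j l - (l == j)%:R * a k i.
Proof. by rewrite mxE [X in _ + X]mxE mul_E_entry mulr_E_entry. Qed.

Lemma comm_comm_E_entry a i j k l :
  comm (E j i) (comm (E i j) a) k l =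
  (k == j)%:R * a k l - (k == j)%:R * (l == j)%:R * a i i
  - (k == i)%:R * (l == i)%:R * a j j + (l == i)%:R * a k l.
Proof.
rewrite !comm_E_entry !eqxx.
by case: (eqVneq k j) => [->|_]; case: (eqVneq l i) => [->|_];
   rewrite ?eqxx /=; ring.
Qed.

Lemma comm_diag_entry a i k l :
  comm (E i i) a k l = ((k == i)%:R - (l == i)%:R) * a k l.
Proof.
rewrite comm_E_entry mulrBl; congr (_ - _).
  by case: eqVneq => [->|_]; rewrite ?mul0r.
by case: eqVneq => [->|_]; rewrite ?mul0r.
Qed.

Lemma lindblad_entry a i j k l :
  ((E i j)^† *m comm a (E i j) + comm (E i j)^† a *m E i j) k l =
  (k == j)%:R * (l == j)%:R * (2 * a i i)
  - (k == j)%:R * a k l - (l == j)%:R * a k l.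
Proof.
have -> : comm a (E i j) = - comm (E i j) a by rewrite opprB.
rewrite adj_E mxE mul_E_entry mulr_E_entry mxE !comm_E_entry !eqxx.
case: (eqVneq k j) => [->|_]; case: (eqVneq l j) => [->|_];
  rewrite /=; ring.
Qed.

End Entries.

(** * The generator and double commutators, entrywise *)

Section Generator.
Local Open Scope complex_scope.
Set Implicit Arguments.
Unset Strict Implicit.
Variable R : realType.
Notation C := R[i].
Notation A := 'M[C]_3.
Implicit Types (a b : A) (i j k l : 'I_3) (Y : 'M[R]_3).

Definition weight (l2 l3 : R) Y i j : R := Y i j * (lam l2 l3 i / lam l2 l3 j).
Definition colweight (l2 l3 : R) Y j : R := \sum_i weight l2 l3 Y i j.
Definition norm2 (l2 l3 : R) : R := \sum_i lam l2 l3 i ^+ 2.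

Lemma lam_gt0 (l2 l3 : R) i : 0 < l2 -> 0 < l3 -> 0 < lam l2 l3 i.
Proof. by case: i => [[|[|[|]]]]. Qed.

Lemma norm2_gt0 (l2 l3 : R) : 0 < l2 -> 0 < l3 -> 0 < norm2 l2 l3.
Proof.
move=> l2_gt0 l3_gt0; rewrite /norm2 big_ord_recl.
rewrite ltr_pwDl ?exprn_gt0 ?lam_gt0 //.
by apply: sumr_ge0 => i _; rewrite sqr_ge0.
Qed.

Lemma expR_half_omega (l2 l3 : R) i j : 0 < l2 -> 0 < l3 ->
  expR (- omega l2 l3 i j / 2) = lam l2 l3 i / lam l2 l3 j.
Proof.
move=> l2_gt0 l3_gt0.
have ratio_gt0 : 0 < lam l2 l3 i / lam l2 l3 j by rewrite divr_gt0 ?lam_gt0.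
rewrite /omega opprK -expr_div_n lnXn //.
rewrite -[ln _ *+ 2]mulr_natr mulfK ?pnatr_eq0 //.
by rewrite lnK // posrE.
Qed.

(** L_Y multiplies off-diagonal matrix units by scalars and acts on the diagonal
as a weighted graph Laplacian. *)
Lemma L_entry (l2 l3 : R) Y a k l : 0 < l2 -> 0 < l3 ->
  L l2 l3 Y a k l =
  (colweight l2 l3 Y k + colweight l2 l3 Y l)%:C * a k l
  - (k == l)%:R * \sum_i (weight l2 l3 Y i k)%:C * (2 * a i i).
Proof.
move=> l2_gt0 l3_gt0; rewrite mxE summxE.
have term i : (\sum_j (Y i j * expR (- omega l2 l3 i j / 2))%:C *:
      ((E i j)^† *m comm a (E i j) + comm (E i j)^† a *m E i j)) k l =
    (k == l)%:R * ((weight l2 l3 Y i k)%:C * (2 * a i i))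
    - (weight l2 l3 Y i k)%:C * a k l - (weight l2 l3 Y i l)%:C * a k l.
  pose w j := (weight l2 l3 Y i j)%:C.
  rewrite summxE eq_sym.
  rewrite -(sum_delta k (fun j => (l == j)%:R * (w j * (2 * a i i)))).
  rewrite -(sum_delta k (fun j => w j * a k l)).
  rewrite -(sum_delta l (fun j => w j * a k l)) -!sumrB; apply: eq_bigr => j _.
  rewrite mxE lindblad_entry expR_half_omega // -/(weight _ _ _ _ _) -/(w j).
  move: (w j) (a i i) (a k l) => x y z; ring.
rewrite (eq_bigr _ (fun i _ => term i)) !sumrB -mulr_sumr -!mulr_suml.
rewrite !raddfD /= !rmorph_sum /=.
move: (\sum_i _) (\sum_i _) (\sum_i _) => x y z; ring.
Qed.

Lemma tr_adj_comm a b c :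
  \tr ((comm b a)^† *m c) = \tr (a^† *m comm b^† c) :> C.
Proof.
rewrite /comm adjB !adjM mulmxBl mulmxBr !raddfB /= !mulmxA.
by rewrite -[b^† *m _ *m c]mulmxA [\tr (b^† *m _)]mxtrace_mulC.
Qed.

Lemma tr_EM i j a : \tr ((E i j)^† *m a) = a i j.
Proof.
rewrite adj_E /mxtrace -[RHS](sum_delta j (fun k => a i k)).
by apply: eq_bigr => k _; rewrite mul_E_entry eq_sym.
Qed.

(** By cyclicity of the trace, f is the trace form of the operator
a |-> L(a) D, where D is the unnormalized density of rho. *)
Lemma f_tr (l2 l3 : R) Y a b (m : A) :
  (forall k l, m k l = L l2 l3 Y a k l * (lam l2 l3 l ^+ 2)%:C) ->
  f l2 l3 Y a b = (norm2 l2 l3)^-1%:C * \tr (b^† *m m).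
Proof.
move=> mE; rewrite /f /rho mxtrace_mulC -mulmxA mul_mx_diag.
congr (_ * \tr (_ *m _)); apply/matrixP => k l.
by rewrite mE !mxE.
Qed.

Lemma f_E_offdiag (l2 l3 : R) Y k l : 0 < l2 -> 0 < l3 -> k != l ->
  f l2 l3 Y (E k l) (E k l) =
  ((norm2 l2 l3)^-1 *
   ((colweight l2 l3 Y k + colweight l2 l3 Y l) * lam l2 l3 l ^+ 2))%:C.
Proof.
move=> l2_gt0 l3_gt0 kl.
rewrite (@f_tr _ _ _ _ _ (\matrix_(i, j) (L l2 l3 Y (E k l) i j
   * (lam l2 l3 j ^+ 2)%:C))); last by move=> i j; rewrite mxE.
rewrite tr_EM mxE L_entry // (negPf kl) mul0r subr0 mxE !eqxx mulr1.
by rewrite !rmorphM.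
Qed.

(** The general double commutator operator that is covariant under conjugation
by diagonal unitaries. *)
Definition dcomm (p q : 'I_3 -> 'I_3 -> R) (a : A) : A :=
  \sum_i \sum_j ((p i j)%:C *: comm (E j i) (comm (E i j) a)
     + (q i j)%:C *: comm (E j j) (comm (E i i) a)).

(** On the diagonal only the symmetric part of p enters; off the diagonal q
contributes only through its second differences. *)
Lemma dcomm_entry p q a k l :
  dcomm p q a k l =
  (\sum_i p i k + \sum_j p l j
   + ((q k k + q l l) - (q k l + q l k)))%:C * a k l
  - (k == l)%:R * \sum_j (p j k + p k j)%:C * a j j.
Proof.
rewrite /dcomm summxE.
have lin_entry (c d : C) (u v : A) :
    (c *: u + d *: v) k l = c * u k l + d * v k l.
  by rewrite !mxE.
have term i : (\sum_j ((p i j)%:C *: comm (E j i) (comm (E i j) a)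
     + (q i j)%:C *: comm (E j j) (comm (E i i) a))) k l =
   (p i k)%:C * a k l - (l == k)%:R * ((p i k)%:C * a i i)
   - (k == i)%:R * ((l == i)%:R * \sum_j (p i j)%:C * a j j)
   + (l == i)%:R * ((\sum_j (p i j)%:C) * a k l)
   + (k == i)%:R * ((q i k - q i l)%:C * a k l)
   - (l == i)%:R * ((q i k - q i l)%:C * a k l).
  rewrite summxE.
  rewrite -(sum_delta k (fun j => (p i j)%:C * a k l)).
  rewrite -(sum_delta k (fun j => (l == j)%:R * ((p i j)%:C * a i i))).
  have -> : (q i k - q i l)%:C * a k l =
    \sum_j (k == j)%:R * ((q i j)%:C * a k l)
    - \sum_j (l == j)%:R * ((q i j)%:C * a k l).
    by rewrite !sum_delta rmorphB mulrBl.
  rewrite !mulrBr mulr_suml !mulr_sumr -!sumrB -!big_split /= -!sumrB.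
  apply: eq_bigr => j _.
  rewrite lin_entry (comm_comm_E_entry a i j).
  rewrite (comm_diag_entry _ j) (comm_diag_entry a i).
  move: (p i j)%:C (q i j)%:C (a k l) (a i i) (a j j) => x y z t u; ring.
rewrite (eq_bigr _ (fun i _ => term i)).
rewrite !(sumrB, big_split) /= !sum_delta -mulr_sumr -mulr_suml.
have -> : \sum_j (p j k + p k j)%:C * a j j =
  \sum_j (p j k)%:C * a j j + \sum_j (p k j)%:C * a j j.
  by rewrite -big_split; apply: eq_bigr => j _; rewrite /= rmorphD mulrDl.
rewrite !(rmorphB, rmorphD) !rmorph_sum /= (eq_sym l k).
case: (eqVneq k l) => [->|_].
  move: (\sum_j _) (\sum_j _) (\sum_j _) (\sum_j _) (a l l) => x y z t u; ring.
move: (\sum_j _) (\sum_j _) (\sum_j _) (\sum_j _) (a k l) => x y z t u; ring.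
Qed.

End Generator.

(** * Solving for the coefficients *)

Section Coefficients.
Local Open Scope complex_scope.
Set Implicit Arguments.
Unset Strict Implicit.
Variables (R : realType) (l2 l3 : R) (Y : 'M[R]_3).
Hypotheses (l2_gt0 : 0 < l2) (l3_gt0 : 0 < l3) (Ysym : Y^T = Y).
Notation C := R[i].
Notation A := 'M[C]_3.
Notation la := (lam l2 l3).
Notation W := (colweight l2 l3 Y).

(** The antisymmetric part of f on the pair (E_kl, E_lk), times the
normalization of rho. *)
Definition asym (k l : 'I_3) : R := (W k + W l) * (la l ^+ 2 - la k ^+ 2).

(** The part Y_kl lambda_k lambda_l, symmetric because Y is, is forced by the
diagonal block.  The antisymmetric part must have row sums whose differences reproduce
asym k l up to sign and a factor of two; averaging over the three indices leads
to 1/3, which is halved because p_kl - p_lk counts the part twice. *)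
Definition pcoef (k l : 'I_3) : R := Y k l * la k * la l - asym k l / 6.

(** The off-diagonal entries left over by p, split evenly between the positions
(k, l) and (l, k). *)
Definition qcoef (k l : 'I_3) : R :=
  if k == l then 0 else
  (\sum_i pcoef i k + \sum_j pcoef l j - (W k + W l) * la l ^+ 2) / 2.

Lemma Y_swap i j : Y i j = Y j i.
Proof. by rewrite -[in LHS]Ysym mxE. Qed.

Lemma asym_cycle :
  asym 0 1 + asym 1 2 + asym 2 0 =
  - ((1 - l3 ^+ 2 - l2 ^+ 2) * (l3 ^+ 2 - l2 ^+ 2) / (l3 * l2) * Y 1 2
     + (l3 ^+ 2 - 1 - l2 ^+ 2) * (l2 ^+ 2 - 1) / l2 * Y 0 1
     + (l2 ^+ 2 - 1 - l3 ^+ 2) * (1 - l3 ^+ 2) / l3 * Y 0 2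
     + (l3 ^+ 2 - l2 ^+ 2) * Y 0 0
     + (1 - l3 ^+ 2) * Y 1 1
     + (l2 ^+ 2 - 1) * Y 2 2).
Proof.
have sum3 (F : 'I_3 -> R) : \sum_i F i = F 0 + F 1 + F 2.
  rewrite !big_ord_recl big_ord0 addr0 addrA.
  by congr (_ + F _ + F _); apply: val_inj.
rewrite /asym /colweight !sum3 /weight (Y_swap 1 0) (Y_swap 2 0) (Y_swap 2 1).
have -> : la 0 = 1 by []. have -> : la 1 = l2 by []. have -> : la 2 = l3 by [].
move: (Y 0 0) (Y 0 1) (Y 0 2) (Y 1 1) (Y 1 2) (Y 2 2) => a b c d e g.
by field; rewrite !gt_eqF.
Qed.

Hypothesis cycle0 : asym 0 1 + asym 1 2 + asym 2 0 = 0.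

Lemma asymC k l : asym l k = - asym k l.
Proof. by rewrite /asym; ring. Qed.

Lemma asym_cocycle i j k : asym i j + asym j k = asym i k.
Proof.
have asymii l : asym l l = 0 by rewrite /asym subrr mulr0.
have c01 := asymC 0 1; have c12 := asymC 1 2; have c20 := asymC 2 0.
have ord3 (l : 'I_3) : [\/ l = 0, l = 1 | l = 2].
  by case: l => [[|[|[|//]]] ?]; [apply: Or31|apply: Or32|apply: Or33];
     apply: val_inj.
by case: (ord3 i) => ->; case: (ord3 j) => ->; case: (ord3 k) => ->;
   rewrite ?asymii; move: cycle0 c01 c12 c20; lra.
Qed.

(** This is where the cocycle identity enters: the row and column sums of p
differ by a third of the row sums of asym, and for a cocycle the difference of
the row sums at k and l is 3 asym k l. *)
Lemma qcoef_sym k l : qcoef k l = qcoef l k.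
Proof.
rewrite /qcoef eq_sym; case: eqVneq => // _; congr (_ / _).
have row_col m : \sum_j pcoef m j - \sum_i pcoef i m = - (\sum_j asym m j) / 3.
  rewrite -sumrB mulNr mulr_suml -sumrN; apply: eq_bigr => j _.
  by rewrite /pcoef (asymC m j) (Y_swap j m); field.
have row_row : \sum_j asym k j - \sum_j asym l j = 3 * asym k l.
  rewrite -sumrB (eq_bigr (fun=> asym k l)); last first.
    by move=> j _; rewrite -(asym_cocycle k l j) addrK.
  by rewrite sumr_const card_ord mulr_natl.
have asymE : asym k l = (W k + W l) * la l ^+ 2 - (W k + W l) * la k ^+ 2.
  by rewrite /asym mulrBr.
rewrite (addrC (W l)); move: row_row asymE (row_col k) (row_col l).
move: (\sum_j asym k j) (\sum_j asym l j) (asym k l) => x y z.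
move: (\sum_i pcoef i k) (\sum_i pcoef i l) (\sum_i pcoef k i)
  (\sum_i pcoef l i) (_ * la l ^+ 2) (_ * la k ^+ 2) => *; lra.
Qed.

Lemma dcomm_L (a : A) k l :
  dcomm pcoef qcoef a k l = L l2 l3 Y a k l * (la l ^+ 2)%:C.
Proof.
rewrite dcomm_entry L_entry //; case: eqVneq => [->|kl].
  have la_neq0 : la l != 0 by rewrite gt_eqF ?lam_gt0.
  have pp j : pcoef j l + pcoef l j = 2 * weight l2 l3 Y j l * la l ^+ 2.
    by rewrite /pcoef /weight (asymC j l) (Y_swap l j); field.
  have -> : \sum_i pcoef i l + \sum_j pcoef l j = 2 * W l * la l ^+ 2.
    rewrite -big_split /= (eq_bigr _ (fun j _ => pp j)) -mulr_suml -mulr_sumr.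
    by [].
  have -> : \sum_j (pcoef j l + pcoef l j)%:C * a j j =
     (\sum_i (weight l2 l3 Y i l)%:C * (2 * a i i)) * (la l ^+ 2)%:C.
    rewrite mulr_suml; apply: eq_bigr => j _; rewrite pp !rmorphM rmorph_nat.
    ring.
  rewrite /= subrr addr0 !rmorphD !rmorphM /= rmorph_nat.
  move: (\sum_i _) (W l) => x y; ring.
rewrite !mul0r !subr0 (qcoef_sym l k) /qcoef !eqxx (negPf kl) addr0 sub0r.
rewrite mulrAC -rmorphM; congr (_%:C * _).
by move: (\sum_i _) (\sum_i _) => x y; field.
Qed.

End Coefficients.

(** * The matrix of an invariant form *)

Section FormMatrix.
Local Open Scope complex_scope.
Set Implicit Arguments.
Unset Strict Implicit.
Variables (R : realType) (c : R) (p q : 'I_3 -> 'I_3 -> R).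
Notation C := R[i].
Notation A := 'M[C]_3.
Notation AA := 'M[C]_(3 * 3).

Definition formmx : 'M[C]_81 := c%:C *: \sum_i \sum_j
  ((p i j)%:C *: ((dermx (E i j))^† *m dermx (E i j))
   + (q i j)%:C *: ((dermx (E j j))^† *m dermx (E i i))).

(** The pairing is kept as a variable so that [formmx], which pairs the maps
[der], and [dcomm], which pairs commutators, are compared summand by summand. *)
Definition coefsum (h : A -> A -> C) : C := c%:C * \sum_i \sum_j
  ((p i j)%:C * h (E i j) (E i j) + (q i j)%:C * h (E j j) (E i i)).

Lemma eq_coefsum h h' : (forall y x, h y x = h' y x) -> coefsum h = coefsum h'.
Proof.
move=> eq_h; rewrite /coefsum.
by under eq_bigr => i _ do under eq_bigr => j _ do rewrite !eq_h.
Qed.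

Definition derform (T U : AA) : C :=
  coefsum (fun y x => \tr ((der y U)^† *m der x T)).

Lemma formmxE T U : (psi U)^† *m formmx *m psi T = (derform T U)%:M.
Proof.
have expand (u v : 'cV[C]_81) : u^† *m formmx *m v = c%:C *: \sum_i \sum_j
    ((p i j)%:C *: (u^† *m ((dermx (E i j))^† *m dermx (E i j)) *m v)
     + (q i j)%:C *: (u^† *m ((dermx (E j j))^† *m dermx (E i i)) *m v)).
  rewrite /formmx -scalemxAr -scalemxAl mulmx_sumr mulmx_suml; congr (_ *: _).
  apply: eq_bigr => i _; rewrite mulmx_sumr mulmx_suml; apply: eq_bigr => j _.
  by rewrite mulmxDr mulmxDl; congr (_ + _); rewrite -scalemxAr -scalemxAl.
rewrite expand /derform /coefsum -scale_scalar_mx; congr (_ *: _).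
rewrite [RHS]raddf_sum; apply: eq_bigr => i _.
rewrite [RHS]raddf_sum; apply: eq_bigr => j _.
rewrite [RHS]raddfD /=.
congr (_ + _); rewrite -scale_scalar_mx; congr (_ *: _); exact: dermx_form.
Qed.

Lemma derform_lact a b1 b2 b3 b4 :
  derform (lact a (b1 ⊗ b2)) (b3 ⊗ b4) =
  derform (b1 ⊗ b2) (lact a^† (b3 ⊗ b4)).
Proof.
by apply: eq_coefsum => y x; rewrite !der_lact adjM adjK mulmxA.
Qed.

Lemma derform_ract d b1 b2 b3 b4 :
  derform (ract (b1 ⊗ b2) d) (b3 ⊗ b4) =
  derform (b1 ⊗ b2) (ract (b3 ⊗ b4) d^†).
Proof.
apply: eq_coefsum => y x; rewrite !der_ract adjM adjK mulmxA.
by rewrite mxtrace_mulC mulmxA.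
Qed.

Lemma derform_tens1 a b :
  derform (a ⊗ 1%:M) (b ⊗ 1%:M) = c%:C * \tr (b^† *m dcomm p q a).
Proof.
have tr_lin (s t : C) (u v : A) : \tr (b^† *m (s *: u + t *: v)) =
    s * \tr (b^† *m u) + t * \tr (b^† *m v).
  by rewrite mulmxDr -!scalemxAr raddfD /= !linearZ.
rewrite /derform.
rewrite (@eq_coefsum _ (fun y x => \tr (b^† *m comm y^† (comm x a)))).
  rewrite /coefsum /dcomm mulmx_sumr raddf_sum /=; congr (_ * _).
  apply: eq_bigr => i _; rewrite mulmx_sumr raddf_sum; apply: eq_bigr => j _.
  by rewrite /= tr_lin !adj_E.
by move=> y x; rewrite !der_tens !mulmx1 tr_adj_comm.
Qed.

End FormMatrix.

Theorem proposition5p5 (R : realType) :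
  exists P : set (R * R),
    [/\ P `<=` [set p | 0 < p.1 /\ 0 < p.2],
        finite_set [set x : R | 0 < x /\
          infinite_set [set y : R | 0 < y /\ (P (x, y) \/ P (y, x))]]
      & forall (l2 l3 : R) (Y : 'M[R]_3),
          0 < l2 -> 0 < l3 -> ~ P (l2, l3) -> Y^T = Y ->
          (exists X : 'M[R[i]]_81,
            [/\ forall i1 i2 i3 i4 i5 : 'I_9,
                  (psi ((Q i4)^† ⊗ (Q i5)^†))^† *m X
                    *m psi (lact (Q i1) (Q i2 ⊗ Q i3))
                  - (psi (lact (Q i1)^† ((Q i4)^† ⊗ (Q i5)^†)))^† *m X
                    *m psi (Q i2 ⊗ Q i3) = 0,
                forall i1 i2 i3 i4 i5 : 'I_9,
                  (psi ((Q i4)^† ⊗ (Q i5)^†))^† *m X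
                    *m psi (ract (Q i2 ⊗ Q i3) (Q i1))
                  - (psi (ract ((Q i4)^† ⊗ (Q i5)^†) (Q i1)^†))^† *m X
                    *m psi (Q i2 ⊗ Q i3) = 0
              & forall i1 i2 : 'I_9,
                  (psi ((Q i2)^† ⊗ 1%:M))^† *m X *m psi (Q i1 ⊗ 1%:M)
                  - (f l2 l3 Y (Q i1) (Q i2)^†)%:M = 0])
          <->
          (1 - l3 ^+ 2 - l2 ^+ 2) * (l3 ^+ 2 - l2 ^+ 2) / (l3 * l2) * Y 1 2
          + (l3 ^+ 2 - 1 - l2 ^+ 2) * (l2 ^+ 2 - 1) / l2 * Y 0 1
          + (l2 ^+ 2 - 1 - l3 ^+ 2) * (1 - l3 ^+ 2) / l3 * Y 0 2
          + (l3 ^+ 2 - l2 ^+ 2) * Y 0 0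
          + (1 - l3 ^+ 2) * Y 1 1
          + (l2 ^+ 2 - 1) * Y 2 2 = 0].
Proof.
exists set0; split; first exact: sub0set.
  rewrite [X in finite_set X](_ : _ = set0) ?finite_set0 //.
  apply/seteqP; split=> [x [_ []]|//].
  rewrite [X in finite_set X](_ : _ = set0) ?finite_set0 //.
  by apply/seteqP; split=> [y [_ []]|].
move=> l2 l3 Y l2_gt0 l3_gt0 _ Ysym; split=> [[X [lactX ractX fX]]|cond].
  have fE k l : psiform X (E k l ⊗ 1%:M) (E k l ⊗ 1%:M) =
      f l2 l3 Y (E k l) (E k l).
    have [i1 Q1] := Q_surj R k l; have [i2 Q2] := Q_surj R l k.
    have := fX i1 i2; rewrite Q1 Q2 adj_E => /subr0_eq.
    by move=> /(congr1 (fun M : 'M[R[i]]_1 => M 0 0)); rewrite [RHS]mxE eqxx.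
  have asymE (k l : 'I_3) : k != l ->
      bilin X (E k l) (E l k) - bilin X (E l k) (E k l)
      = ((norm2 l2 l3)^-1 * asym l2 l3 Y k l)%:C%C.
    move=> kl; rewrite /bilin !adj_E !fE !f_E_offdiag // 1?eq_sym // -rmorphB.
    by congr (_%:C)%C; rewrite /asym; ring.
  have := cyclic_cocycle lactX ractX 0 2 1.
  rewrite (asymE 0 1) // (asymE 2 0) // (asymE 1 2) //.
  rewrite -!rmorphD -!mulrDr => /(@complexI _ _ 0)/eqP.
  rewrite mulf_eq0 invr_eq0 gt_eqF ?norm2_gt0 //= => /eqP cycle0.
  apply: oppr_inj; rewrite oppr0 -(asym_cycle l2_gt0 l3_gt0 Ysym) -[RHS]cycle0.
  ring.
have cycle0 : asym l2 l3 Y 0 1 + asym l2 l3 Y 1 2 + asym l2 l3 Y 2 0 = 0.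
  by rewrite (asym_cycle l2_gt0 l3_gt0 Ysym) cond oppr0.
exists (formmx (norm2 l2 l3)^-1 (pcoef l2 l3 Y) (qcoef l2 l3 Y)).
split=> [i1 i2 i3 i4 i5|i1 i2 i3 i4 i5|i1 i2]; apply/eqP; rewrite subr_eq0.
- by rewrite !formmxE derform_lact.
- by rewrite !formmxE derform_ract.
rewrite formmxE derform_tens1.
by rewrite (f_tr _ (dcomm_L l2_gt0 l3_gt0 Ysym cycle0 (Q i1))).
Qed.
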